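(* Let $G$ be a locally compact group. If $G$ is non-compact, then every topological left invariant mean $m$ on $GL(G)$ lies in $GL_0(G)^\perp$; that is, $\langle m,f\rangle=0$ for all $f\in GL_0(G)$.
   Context: $M(G)$ is the measure algebra of complex regular Borel measures on $G$ with total variation norm and convolution $*$. A generalised function is a family $f=(f_\mu)_{\mu\in M(G)}\in\prod_{\mu\in M(G)}L^\infty(|\mu|)$ such that $f_\mu=f_\nu$ $|\mu|$-a.e. whenever $\mu\ll\nu$ (meaning $|\mu|$ is absolutely continuous with respect to $|\nu|$). $GL(G)$ is the commutative unital C$^*$-algebra of all generalised functions, with coordinatewise operations, involution $(f_\mu)\mapsto(\overline{f_\mu})$, norm $\|f\|_\infty=\sup_\mu\|f_\mu\|_{\mu,\infty}<\infty$ (where $\|\cdot\|_{\mu,\infty}$ is the $L^\infty(|\mu|)$ norm), and unit $\mathbf 1=(1_\mu)_\mu$. It is identified isometrically with $M(G)^*$ through $\langle f,\zeta\rangle=\int_G f_\zeta\,d\zeta$ ($\zeta\in M(G)$). $f\ge 0$ means $f$ is positive in the C$^*$-algebra sense. For $\zeta\in M(G)$ and $f\in GL(G)$, $\zeta\circ f\in GL(G)$ is the generalised function with $\langle\zeta\circ f,\mu\rangle=\langle f,\zeta*\mu\rangle$ for all $\mu\in M(G)$. A generalised function $f=(f_\mu)$ vanishes at infinity if for each $\varepsilon>0$ there is a compact $K_\varepsilon\subseteq G$ with $\|f_\mu\chi_{G\setminus K_\varepsilon}\|_{\mu,\infty}<\varepsilon$ for all $\mu\in M(G)$; $GL_0(G)$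 is the C$^*$-subalgebra of $GL(G)$ of all generalised functions vanishing at infinity. A mean on $GL(G)$ is a functional $m\in GL(G)^*$ with $m(\mathbf 1)=1$ and $m(f)\ge 0$ whenever $f\ge0$; it is topological left invariant if $m(\zeta\circ f)=m(f)$ for all $f\in GL(G)$ and all $\zeta\in M(G)$ with $\zeta\ge0$ and $\|\zeta\|=1$. $GL_0(G)^\perp=\{m\in GL(G)^*:\langle m,f\rangle=0\text{ for all }f\in GL_0(G)\}$. *)

(* Defs.v *)
From HB Require Import structures.
From mathcomp Require Import all_boot all_order all_algebra.
From mathcomp Require Import complex.
From mathcomp Require Import all_classical all_reals all_analysis.
From mathcomp Require Import ess_sup_inf measurable_realfun hoelder charge.

Set Implicit Arguments.
Unset Strict Implicit.
Unset Printing Implicit Defensive.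

Import Order.TTheory GRing.Theory Num.Theory.
Import numFieldNormedType.Exports.

Local Open Scope classical_set_scope.
Local Open Scope ring_scope.
Local Open Scope complex_scope.

(* A complex measure, given by its real and imaginary parts (finite signed
   measures).  Charges are functions on all sets; only their values on
   measurable sets are meaningful, and nothing below depends on the others. *)
Record complex_measure d (T : measurableType d) (R : realType) := ComplexMeasure {
  cm_Re : {charge set T -> \bar R};
  cm_Im : {charge set T -> \bar R} }.

Definition cm_val d (T : measurableType d) (R : realType)
  (mu : complex_measure T R) (E : set T) : R[i] :=
  fine (cm_Re mu E) +i* fine (cm_Im mu E).

Coercion cm_val : complex_measure >-> Funclass.

Import Normc.

Section variation.
Context d (T : measurableType d) (R : realType).
Implicit Type mu : complex_measure T R.

(* |mu|(E): supremum over finite disjoint measurable families contained in E.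
   For measurable E this equals the supremum over partitions of E, since such a
   family is completed into a partition by adding the remainder. *)
Definition variation mu (E : set T) : \bar R :=
  ereal_sup [set v | exists n (F : nat -> set T),
    [/\ forall i, measurable (F i), trivIset setT F, forall i, F i `<=` E
      & v = (\sum_(0 <= i < n) normc (mu (F i)))%:E]].

Variable mu : complex_measure T R.

Lemma cm_val0 : mu set0 = 0.
Proof. by rewrite /cm_val !charge0. Qed.

Lemma normc_ge0 (z : R[i]) : 0 <= normc z.
Proof. by case: z => a b; exact: sqrtr_ge0. Qed.


Lemma le_variation A B : A `<=` B -> (variation mu A <= variation mu B)%E.
Proof.
move=> AB; apply: le_ereal_sup => _ [n [F [mF tF FA ->]]].
by exists n, F; split=> // i; exact: subset_trans AB.
Qed.

Lemma normc_le_variation F E : measurable F -> F `<=` E ->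
  ((normc (mu F))%:E <= variation mu E)%E.
Proof.
move=> mF FE; apply: ereal_sup_ubound.
exists 1%N, (fun i => if i is 0%N then F else set0); split.
- by case=> [|i] //; exact: measurable0.
- by apply/trivIsetP => -[|i] [|j] //= _ _ _; rewrite ?setI0 ?set0I.
- by case=> [|i] //; exact: sub0set.
- by rewrite big_nat1.
Qed.

Lemma variation_ge0 E : (0 <= variation mu E)%E.
Proof.
by rewrite (le_trans _ (normc_le_variation measurable0 (@sub0set _ E)))// lee_fin normc_ge0.
Qed.

Lemma variation0 : variation mu set0 = 0%E.
Proof.
apply/eqP; rewrite eq_le variation_ge0 andbT.
apply: ub_ereal_sup => _ [n [F [_ _ F0 ->]]].
rewrite lee_fin big1// => i _.
by have := F0 i; rewrite subset0 => ->; rewrite cm_val0 normc0.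
Qed.

Lemma variation_superadd A B : A `&` B = set0 ->
  (variation mu A + variation mu B <= variation mu (A `|` B))%E.
Proof.
move=> AB0.
have key a b : (exists n (F : nat -> set T),
    [/\ forall i, measurable (F i), trivIset setT F, forall i, F i `<=` A
      & a = (\sum_(0 <= i < n) normc (mu (F i)))%:E]) ->
   (exists n (F : nat -> set T),
    [/\ forall i, measurable (F i), trivIset setT F, forall i, F i `<=` B
      & b = (\sum_(0 <= i < n) normc (mu (F i)))%:E]) ->
   (a + b <= variation mu (A `|` B))%E.
  move=> [n [F [mF tF FA ->]]] [m [H [mH tH HB ->]]].
  apply: ereal_sup_ubound.
  exists (n + m)%N, (fun i => if (i < n)%N then F i else H (i - n)%N); split.
  - by move=> i; case: ifP.
  - have FH i j : F i `&` H j = set0.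
      by rewrite -subset0 -AB0; exact: setISS.
    apply/trivIsetP => i j _ _ ij; case: ifPn => [il|il]; case: ifPn => [jl|jl].
    + by move/trivIsetP : tF; apply.
    + exact: FH.
    + by rewrite setIC FH.
    + move/trivIsetP : tH; apply => //; apply: contra ij => /eqP.
      rewrite -!leqNgt in il jl; move=> /(congr1 (addn n)).
      by rewrite !subnKC// => ->.
  - move=> i; case: ifP => _ x Fx; first by left; exact: (FA i).
    by right; exact: (HB (i - n)%N).
  - rewrite -EFinD; congr EFin; rewrite (big_cat_nat (leq0n n) (leq_addr m n))//=; congr (_ + _).
      by apply: eq_big_nat => i /andP[_ ->].
    rewrite (_ : \sum_(n <= i < n + m) _ = \sum_(0 + n <= i < n + m)
      normc (mu (if (i < n)%N then F i else H (i - n)%N)))// big_addn addKn.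
    by apply: eq_bigr => i _; rewrite ltnNge leq_addl/= addnK.
case: (eqVneq (variation mu (A `|` B)) +oo%E) => [->|ABoo]; first exact: leey.
have fin C : C `<=` A `|` B -> variation mu C \is a fin_num.
  move=> CAB; rewrite ge0_fin_numE ?variation_ge0//.
  by rewrite (le_lt_trans (le_variation CAB))// ltey.
have fA := fin A (@subsetUl _ _ _); have fB := fin B (@subsetUr _ _ _).
rewrite -leeBrDr//; apply: ub_ereal_sup => a ha.
rewrite leeBrDr// addeC -leeBrDr; last by case: ha => n [F [_ _ _ ->]].
apply: ub_ereal_sup => b hb.
by rewrite leeBrDr; [rewrite addeC; exact: key|case: ha => n [F [_ _ _ ->]]].
Qed.

Lemma normc_series (F : nat -> set T) :
  (forall i, measurable (F i)) -> trivIset setT F ->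
  ((normc (mu (\bigcup_i F i)))%:E <= \sum_(0 <= i <oo) (normc (mu (F i)))%:E)%E.
Proof.
move=> mF tF; set S := (X in (_ <= X)%E).
have S0 : (0 <= S)%E by apply: nneseries_ge0 => *; rewrite lee_fin normc_ge0.
have [->|Soo] := eqVneq S +oo%E; first exact: leey.
have Sfin : S \is a fin_num by rewrite ge0_fin_numE// ltey.
have mU : measurable (\bigcup_i F i) by exact: bigcup_measurable.
have cv (nu : {charge set T -> \bar R}) :
    (fun n => \sum_(0 <= i < n) fine (nu (F i))) @ \oo --> fine (nu (\bigcup_i F i)).
  have h := @charge_semi_sigma_additive _ _ _ nu _ mF tF mU.
  have {}h : (fun n => \sum_(0 <= i < n) nu (F i))%E @ \oo --> (fine (nu (\bigcup_i F i)))%:E.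
    by rewrite fineK ?fin_num_measure//; exact: h.
  move/fine_cvg : h; apply: cvg_trans; apply: near_eq_cvg; apply: nearW => n /=.
  rewrite sum_fine // => i _; exact: fin_num_measure.
rewrite -(fineK Sfin) lee_fin /cm_val /= -(ger0_norm (fine_ge0 S0)) -sqrtr_sqr.
rewrite ler_sqrt ?sqr_ge0//.
apply: (@ler_cvg_to _ \oo _ _
  (fun n => (\sum_(0 <= i < n) fine (cm_Re mu (F i))) ^+ 2
     + (\sum_(0 <= i < n) fine (cm_Im mu (F i))) ^+ 2)
  (fun=> fine S ^+ 2)).
- by apply: cvgD; under eq_fun do rewrite expr2; rewrite expr2; apply: cvgM; exact: cv.
- exact: cvg_cst.
- apply: nearW => n.
  suff : normc (\sum_(0 <= i < n) mu (F i)) <= fine S.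
    have -> : \sum_(0 <= i < n) mu (F i) =
       (\sum_(0 <= i < n) fine (cm_Re mu (F i))) +i* (\sum_(0 <= i < n) fine (cm_Im mu (F i))).
      elim: n => [|n IH]; first by rewrite !big_geq.
      by rewrite !big_nat_recr//= {}IH /cm_val; simpc.
    rewrite /= => h; rewrite -[leLHS]sqr_sqrtr ?addr_ge0 ?sqr_ge0//.
    by rewrite ler_sqr ?nnegrE ?sqrtr_ge0// fine_ge0.
  apply: (@le_trans _ _ (\sum_(0 <= i < n) normc (mu (F i)))).
    elim/big_ind2 : _ => //; first by rewrite normc0.
    move=> x1 x2 y1 y2 h1 h2; apply: le_trans (lerD h1 h2).
    exact: le_normcD.
  rewrite -lee_fin fineK// -sumEFin.
  by apply: nneseries_lim_ge => *; rewrite lee_fin normc_ge0.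
Qed.

Lemma variation_sigma_additive : semi_sigma_additive (variation mu).
Proof.
move=> E mE tE mUE.
have cvgS : (fun n => \sum_(0 <= i < n) variation mu (E i))%E @ \oo -->
    (\sum_(0 <= i <oo) variation mu (E i))%E.
  by apply: is_cvg_nneseries => *; exact: variation_ge0.
suff -> : variation mu (\bigcup_n E n) = (\sum_(0 <= i <oo) variation mu (E i))%E by [].
apply/eqP; rewrite eq_le; apply/andP; split.
- apply: ub_ereal_sup => _ [n [F [mF tF FE ->]]].
  rewrite -sumEFin.
  apply: (@le_trans _ _ (\sum_(0 <= i < n)
      \sum_(0 <= k <oo) (normc (mu (F i `&` E k)))%:E)%E).
    apply: lee_sum => i _.
    rewrite -{1}(setIidl (FE i)) setI_bigcupr; apply: normc_series.
      by move=> k; exact: measurableI.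
    by apply: trivIset_setIl.
  rewrite -nneseries_sum_nat//; last by move=> *; rewrite lee_fin normc_ge0.
  apply: lee_nneseries => [k _ _|k _]; first by apply: sume_ge0 => *; rewrite lee_fin normc_ge0.
  rewrite sumEFin; apply: ereal_sup_ubound; exists n, (fun i => F i `&` E k); split=> //.
  + by move=> i; exact: measurableI.
  + exact: trivIset_setIr.
- apply: lime_le; first by apply: is_cvg_nneseries => *; exact: variation_ge0.
  apply: nearW => n.
  apply: (@le_trans _ _ (variation mu (\big[setU/set0]_(i < n) E i))); last first.
    by apply: le_variation; rewrite -bigcup_mkord => x [i _ Eix]; exists i.
  elim: n => [|n IH]; first by rewrite big_geq// variation_ge0.
  rewrite big_nat_recr//= big_ord_recr/=.
  apply: le_trans (variation_superadd _); first exact: leeD.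
  rewrite -bigcup_mkord setI_bigcupl bigcup0// => i /= ni.
  by move/trivIsetP : tE; apply => //; rewrite (ltn_eqF ni).
Qed.

HB.instance Definition _ := isMeasure.Build d T R (variation mu)
  variation0 variation_ge0 variation_sigma_additive.

End variation.

Section integral.
Context d (T : measurableType d) (R : realType).

(* Integration against a charge goes through its Jordan decomposition, which
   does not depend on the Hahn decomposition chosen here. *)
Definition hahn_pair (nu : {charge set T -> \bar R}) :
    {PN : set T * set T | hahn_decomposition nu PN.1 PN.2}.
Proof.
have [P] := cid (Hahn_decomposition nu); move=> /cid[N nuPN].
by exists (P, N).
Defined.

Definition charge_integral (nu : {charge set T -> \bar R}) (f : T -> R) : R :=
  \int[jordan_pos (svalP (hahn_pair nu))]_x f x
  - \int[jordan_neg (svalP (hahn_pair nu))]_x f x.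

(* int f dmu, expanded from (f1 + i f2) d(mu1 + i mu2) *)
Definition cintegral (mu : complex_measure T R) (f : T -> R[i]) : R[i] :=
  (charge_integral (cm_Re mu) (fun x => complex.Re (f x))
   - charge_integral (cm_Im mu) (fun x => complex.Im (f x)))
  +i* (charge_integral (cm_Re mu) (fun x => complex.Im (f x))
       + charge_integral (cm_Im mu) (fun x => complex.Re (f x))).

Definition cmeasurable (f : T -> R[i]) :=
  measurable_fun [set: T] (fun x => complex.Re (f x)) /\
  measurable_fun [set: T] (fun x => complex.Im (f x)).

Definition Linfty_norm (mu : complex_measure T R) (f : T -> R[i]) : \bar R :=
  Lnorm (variation mu) +oo%E (fun x => (normc (f x))%:E).

End integral.

(* The distinguished point is irrelevant: the library equips generated
   sigma-algebras with a measurable structure only over pointed types. *)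
HB.mixin Record isTopologicalGroup G & PointedTopological G & Group G := {
  mulg_continuous : continuous (fun p : G * G => (p.1 * p.2)%g) ;
  invg_continuous : continuous (fun x : G => (x^-1)%g) }.

#[short(type=topologicalGroupType)]
HB.structure Definition TopologicalGroup :=
  {G of PointedTopological G & Group G & isTopologicalGroup G}.

Notation borel G := (g_sigma_algebraType (@open G)).

Section measure_algebra.
Context (R : realType) (G : topologicalGroupType).

Definition regular_measure (mu : complex_measure (borel G) R) :=
  forall (E : set (borel G)) (e : R), measurable E -> 0 < e ->
  exists K U : set G, [/\ compact K, open U, K `<=` E, E `<=` U
    & (variation mu (U `\` K) < e%:E)%E].

(* M(G) *)
Record measure_algebra := MeasureAlgebra {
  ma_val :> complex_measure (borel G) R ;
  ma_regular : regular_measure ma_val }.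

Implicit Types mu nu lam : measure_algebra.

Definition nonnegative mu :=
  forall E : set (borel G), measurable E -> 0 <= mu E.

Definition total_variation mu : \bar R := variation mu [set: borel G].

(* lam = mu * nu, i.e. lam E = int int 1_E(x y) dmu(x) dnu(y); this determines
   lam on Borel sets. *)
Definition is_convolution mu nu lam :=
  forall E : set (borel G), measurable E ->
    lam E = cintegral nu (fun y => mu [set x | E ((x : G) * y)%g]).

(* Families (f_mu)_mu of functions; f mu is a representative of the class f_mu
   in L^oo(|mu|). *)
Definition family := measure_algebra -> borel G -> R[i].

Definition family_norm (f : family) : \bar R :=
  ereal_sup [set Linfty_norm mu (f mu) | mu in [set: measure_algebra]].

Definition generalised_function (f : family) : Prop :=
  [/\ forall mu, cmeasurable (f mu),
      forall mu nu, variation mu `<< variation nu ->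
        {ae variation mu, forall x, f mu x = f nu x}
    & (family_norm f < +oo)%E].

End measure_algebra.

Section generalised_function_algebra.
Context (R : realType) (G : topologicalGroupType).
Local Notation M := (measure_algebra R G).
Local Notation family := (family R G).
Implicit Types (f g : family) (mu nu : M).

Lemma family_normP f : (family_norm f < +oo)%E <->
  exists C : R, forall mu, {ae variation mu, forall x, normc (f mu x) <= C}.
Proof.
split=> [foo|[C fC]].
  exists (fine (family_norm f)) => mu.
  have le_mu : (Linfty_norm mu (f mu) <= family_norm f)%E.
    by apply: ereal_sup_ubound; exists mu.
  have f0 : (0 <= family_norm f)%E by apply: le_trans le_mu; exact: Lnorm_ge0.
  have ffin : family_norm f \is a fin_num by rewrite ge0_fin_numE.
  move: le_mu; rewrite /Linfty_norm unlock; case: ifPn => [mu0|mu0 _].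
    rewrite -{1}(fineK ffin) => /ess_supP; apply: filterS => x /=.
    by rewrite lee_fin; exact: le_trans (ler_norm _).
  have {}mu0 : variation mu [set: borel G] = 0%E.
    by apply/eqP; rewrite eq_le variation_ge0 andbT leNgt.
  by exists setT; split.
apply: (@le_lt_trans _ _ (Num.max C 0)%:E); last exact: ltry.
apply: ub_ereal_sup => _ [mu _ <-]; rewrite /Linfty_norm unlock.
case: ifPn => [mu0|mu0]; last by rewrite lee_fin le_max lexx orbT.
apply/ess_supP; apply: filterS (fC mu) => x /= fx.
by rewrite lee_fin ger0_norm ?normc_ge0// le_max fx.
Qed.

Lemma generalised_function_cst (c : R[i]) :
  generalised_function ((fun _ _ => c) : family).
Proof.
split.
- by move=> mu; split; exact: measurable_cst.
- by move=> mu nu _; exact: aeW.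
- by apply/family_normP; exists (normc c) => mu; exact: aeW.
Qed.

Lemma generalised_functionD f g :
  generalised_function f -> generalised_function g -> generalised_function (f + g).
Proof.
move=> [mf cf /family_normP[C fC]] [mg cg /family_normP[D gD]]; split.
- move=> mu; have [f1 f2] := mf mu; have [g1 g2] := mg mu; split.
  + rewrite [X in measurable_fun _ X](_ : _ =
      (fun x => complex.Re (f mu x)) \+ (fun x => complex.Re (g mu x))).
      exact: measurable_funD.
    apply/funext => x; change (complex.Re (f mu x + g mu x) = complex.Re (f mu x) + complex.Re (g mu x)).
    by case: (f mu x) (g mu x) => ? ? [].
  + rewrite [X in measurable_fun _ X](_ : _ =
      (fun x => complex.Im (f mu x)) \+ (fun x => complex.Im (g mu x))).
      exact: measurable_funD.
    apply/funext => x; change (complex.Im (f mu x + g mu x) = complex.Im (f mu x) + complex.Im (g mu x)).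
    by case: (f mu x) (g mu x) => ? ? [].
- move=> mu nu munu; apply: filterS2 (cf _ _ munu) (cg _ _ munu) => x fx gx.
  by change (f mu x + g mu x = f nu x + g nu x); rewrite fx gx.
- apply/family_normP; exists (C + D) => mu.
  apply: filterS2 (fC mu) (gD mu) => x fx gx.
  exact: le_trans (le_normcD _ _) (lerD fx gx).
Qed.

Lemma generalised_functionM f g :
  generalised_function f -> generalised_function g -> generalised_function (f * g).
Proof.
move=> [mf cf /family_normP[C fC]] [mg cg /family_normP[D gD]]; split.
- move=> mu; have [f1 f2] := mf mu; have [g1 g2] := mg mu; split.
  + rewrite [X in measurable_fun _ X](_ : _ =
      ((fun x => complex.Re (f mu x)) \* (fun x => complex.Re (g mu x)))
      \- ((fun x => complex.Im (f mu x)) \* (fun x => complex.Im (g mu x)))).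
      by apply: measurable_funB; exact: measurable_funM.
    apply/funext => x; change (complex.Re (f mu x * g mu x) = complex.Re (f mu x) * complex.Re (g mu x) - complex.Im (f mu x) * complex.Im (g mu x)).
    by case: (f mu x) (g mu x) => ? ? [].
  + rewrite [X in measurable_fun _ X](_ : _ =
      ((fun x => complex.Re (f mu x)) \* (fun x => complex.Im (g mu x)))
      \+ ((fun x => complex.Im (f mu x)) \* (fun x => complex.Re (g mu x)))).
      by apply: measurable_funD; exact: measurable_funM.
    apply/funext => x; change (complex.Im (f mu x * g mu x) = complex.Re (f mu x) * complex.Im (g mu x) + complex.Im (f mu x) * complex.Re (g mu x)).
    by case: (f mu x) (g mu x) => ? ? [].
- move=> mu nu munu; apply: filterS2 (cf _ _ munu) (cg _ _ munu) => x fx gx.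
  by change (f mu x * g mu x = f nu x * g nu x); rewrite fx gx.
- apply/family_normP; exists (C * D) => mu.
  apply: filterS2 (fC mu) (gD mu) => x fx gx.
  rewrite [leLHS](_ : _ = normc (f mu x) * normc (g mu x)); last exact: Normc.normcM.
  by apply: ler_pM => //; exact: normc_ge0.
Qed.

Lemma generalised_function_conj f :
  generalised_function f -> generalised_function ((fun mu x => (f mu x)^*%C) : family).
Proof.
move=> [mf cf /family_normP[C fC]]; split.
- move=> mu; have [f1 f2] := mf mu; split.
  + rewrite [X in measurable_fun _ X](_ : _ = fun x => complex.Re (f mu x))//.
    by apply/funext => x; case: (f mu x).
  + rewrite [X in measurable_fun _ X](_ : _ = \- (fun x => complex.Im (f mu x))).
      exact: measurableT_comp.
    by apply/funext => x /=; case: (f mu x).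
- by move=> mu nu munu; apply: filterS (cf _ _ munu) => x ->.
- apply/family_normP; exists C => mu; apply: filterS (fC mu) => x.
  by case: (f mu x) => a b /=; rewrite sqrrN.
Qed.

Definition gl_pred : {pred family} := fun f => `[< generalised_function f >].

Lemma gl_subring_closed : subring_closed gl_pred.
Proof.
have N f : generalised_function f -> generalised_function (- f).
  by move=> hf; rewrite -mulN1r; apply: generalised_functionM => //; exact: (generalised_function_cst (-1)).
split=> [|f g /asboolP hf /asboolP hg|f g /asboolP hf /asboolP hg]; apply/asboolP.
- exact: (generalised_function_cst 1).
- by apply: generalised_functionD => //; exact: N.
- exact: generalised_functionM.
Qed.

Lemma gl_submod_closed : submod_closed gl_pred.
Proof.
split=> [|a f g /asboolP hf /asboolP hg]; apply/asboolP.
  exact: (generalised_function_cst 0).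
apply: generalised_functionD => //.
exact: (generalised_functionM (generalised_function_cst a) hf).
Qed.

HB.instance Definition _ := GRing.isSubringClosed.Build _ gl_pred gl_subring_closed.
HB.instance Definition _ := GRing.isSubmodClosed.Build _ _ gl_pred gl_submod_closed.

(* GL(G), before identifying |mu|-a.e. equal coordinates: gl_norm below is a
   seminorm whose null space is the class of 0 for gl_eq.  The functionals of
   GL_dual are bounded for this seminorm, hence compatible with gl_eq, and are
   exactly the bounded functionals on the quotient. *)
Record GL := MkGL {
  gl_val :> M -> borel G -> R[i] ;
  gl_valP : gl_val \in gl_pred }.

HB.instance Definition _ := [isSub for gl_val].
HB.instance Definition _ := [Choice of GL by <:].
HB.instance Definition _ := GRing.SubChoice_isSubComPzRing.Build _ gl_pred GL gl_subring_closed.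
HB.instance Definition _ := [SubZmodule_isSubLmodule of GL by <:].

End generalised_function_algebra.

Section dual.
Context (R : realType) (G : topologicalGroupType).
Local Notation M := (measure_algebra R G).
Local Notation GL := (GL R G).
Implicit Types (f g h : GL) (mu nu lam zeta : M).

Definition gl_norm f : \bar R := family_norm f.

Definition gl_eq f g :=
  forall mu, {ae variation mu, forall x, f mu x = g mu x}.

Lemma gl_conj_subproof f :
  ((fun mu x => (f mu x)^*%C) : family R G) \in @gl_pred R G.
Proof. by apply/asboolP/generalised_function_conj/asboolP/gl_valP. Qed.

Definition gl_conj f : GL := MkGL (gl_conj_subproof f).

(* positivity in a C*-algebra: f = g^* g *)
Definition gl_ge0 f := exists g, gl_eq f (gl_conj g * g).

Definition pairing f zeta : R[i] := cintegral zeta (f zeta).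

(* g = zeta o f, i.e. <g, mu> = <f, zeta * mu> for all mu *)
Definition is_circ zeta f g :=
  forall mu, exists2 lam, is_convolution zeta mu lam & pairing g mu = pairing f lam.

Definition vanishes_at_infinity f :=
  forall e : R, 0 < e -> exists2 K : set G, compact K &
    forall mu, (Linfty_norm mu (fun x => (f mu x * (\1_(~` K) x)%:C)%R) < e%:E)%E.

Definition GL0 : set GL := [set f | vanishes_at_infinity f].

Record GL_dual := MkGLDual {
  gl_functional :> {scalar GL} ;
  gl_functional_bounded : exists C : R, forall f,
    ((normc (gl_functional f))%:E <= C%:E * gl_norm f)%E }.

Definition is_mean (m : GL_dual) :=
  m 1 = 1 /\ forall f, gl_ge0 f -> 0 <= m f.

Definition topological_left_invariant (m : GL_dual) :=
  forall zeta f g, nonnegative zeta -> total_variation zeta = 1%E ->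
    is_circ zeta f g -> m g = m f.

Definition annihilator (A : set GL) : set GL_dual :=
  [set m | forall f, A f -> m f = 0].

End dual.

(* Main.v *)
Require Import Defs.
From HB Require Import structures.
From mathcomp Require Import all_boot all_order all_algebra.
From mathcomp Require Import complex.
From mathcomp Require Import all_classical all_reals all_analysis.
From mathcomp Require Import measurable_realfun charge ring lra.
Import Defs.

Set Implicit Arguments.
Unset Strict Implicit.
Unset Printing Implicit Defensive.

Import Order.TTheory GRing.Theory Num.Theory.
Import numFieldNormedType.Exports.

Local Open Scope classical_set_scope.
Local Open Scope ring_scope.
Local Open Scope complex_scope.

Import Normc.

(** The indicator [\1_K] of a compact set [K] is regarded as the generalised
function all of whose coordinates are [\1_K].  The point mass at
[x] acts on it by translation: [delta_x o \1_K] is the indicator of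
[x^-1 K].  An invariant mean [m] therefore gives the same value to all the
translates of [\1_K].

Since [G] is not compact, the translates of [K] can be made pairwise disjoint:
the [x] for which [x^-1 K] meets a given compact [L] form the compact set
[K L^-1], so some [x] avoids it.  Adding one translate at a time produces, for
every [n], a compact set whose indicator has mean [n * m \1_K]
([mean_indic_multiples]).  Such an indicator is at most [1], so
[n * m \1_K <= 1] for every [n], and [m \1_K = 0] ([mean_indic_compact]).

A positive functional satisfies the Cauchy-Schwarz inequality
[|m (p^* h)|^2 <= m (p^* p) m (h^* h)]; only its degenerate case
[mean_cauchy_schwarz0] is used.  It gives [m (f \1_K) = 0] for every [f], that
is, [m f = m (f \1_(~` K))].  When [f] vanishes at infinity, [K] can be chosen
so that [f \1_(~` K)] has arbitrarily small norm, and [m] is bounded; hence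
[m f = 0].

What invariance asks about [delta_x] is checked on Borel measures: [delta_x] is
a regular measure of total variation 1, and its convolution with [mu] is the
image of [mu] under left translation by [x], again a regular measure. *)

(** * Integrals of indicator functions *)

Section indicator_integral.
Context d (T : measurableType d) (R : realType).

Lemma charge_integral0 (nu : {charge set T -> \bar R}) :
  charge_integral nu (fun=> 0) = 0.
Proof. by rewrite /charge_integral /Rintegral !integral0 subrr. Qed.

Lemma charge_integral_indic (nu : {charge set T -> \bar R}) (E : set T) :
  measurable E -> charge_integral nu \1_E = fine (nu E).
Proof.
move=> mE; rewrite /charge_integral /Rintegral !integral_indic// !setIT.
set p := jordan_pos _; set n := jordan_neg _.
have fp : p E \is a fin_num by exact: fin_num_measure.
have fn : n E \is a fin_num by exact: fin_num_measure.
have -> : nu E = (p E - n E)%E.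
  by rewrite (jordan_decomp (svalP (hahn_pair nu)) mE) /cadd/= cscaleN1.
by rewrite fineB.
Qed.

Lemma cintegral_indic (mu : complex_measure T R) (E : set T) :
  measurable E -> cintegral mu (fun x => (\1_E x)%:C) = mu E.
Proof.
move=> mE; rewrite /cintegral /= !charge_integral0 !charge_integral_indic//.
by rewrite subr0 add0r.
Qed.

End indicator_integral.

(** * Images of complex measures *)

Section pushforward.
Context d1 d2 (T1 : measurableType d1) (T2 : measurableType d2) (R : realType).
Variables (phi : T1 -> T2) (mphi : measurable_fun [set: T1] phi).

(** The image of a charge is a charge only along a measurable map, so its charge
structure is built from [mphi] explicitly. *)
Definition charge_pushforward (nu : {charge set T1 -> \bar R}) :
    {charge set T2 -> \bar R} :=
  measure_function_pushforward__canonical__charge_Charge nu mphi.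

Definition cm_pushforward (mu : complex_measure T1 R) : complex_measure T2 R :=
  ComplexMeasure (charge_pushforward (cm_Re mu)) (charge_pushforward (cm_Im mu)).

(** Preimages of disjoint sets are disjoint, so a family competing for the left
side pulls back to one competing for the right.  The inequality can be strict,
as [phi] may merge sets on which [mu] cancels. *)
Lemma variation_pushforward_le mu (E : set T2) :
  (variation (cm_pushforward mu) E <= variation mu (phi @^-1` E))%E.
Proof.
apply: ge_ereal_sup => _ [n [F [mF tF FE ->]]]; apply: ereal_sup_ubound.
exists n, (fun i => phi @^-1` F i); split => //.
- by move=> i; rewrite -[X in measurable X]setTI; exact: mphi.
- apply/trivIsetP => i j _ _ ij; rewrite -preimage_setI.
  by move/trivIsetP : tF => /(_ _ _ _ _ ij) ->//; rewrite preimage_set0.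
- by move=> i x; exact: FE.
Qed.

End pushforward.

(** * Point masses *)

Section point_mass.
Context d (T : measurableType d) (R : realType) (x : T).

Definition cm_dirac : complex_measure T R :=
  ComplexMeasure (charge_of_finite_measure \d_x) czero.

Lemma cm_diracE (E : set T) : cm_dirac E = (\1_E x)%:C.
Proof. by []. Qed.

(** At most one member of a disjoint family contains [x], so the best family is
[E] alone. *)
Lemma variation_dirac (E : set T) : measurable E ->
  variation cm_dirac E = (\1_E x)%:E.
Proof.
move=> mE; apply/eqP; rewrite eq_le; apply/andP; split; last first.
  apply: le_trans (normc_le_variation cm_dirac mE (@subset_refl _ E)).
  by rewrite cm_diracE /= expr0n addr0 sqrtr_sqr lee_fin ler_norm.
apply: ge_ereal_sup => _ [n [F [mF tF FE ->]]].
rewrite (_ : (\sum_(_ <= _ < _) _)%:E = \sum_(0 <= i < n) \d_x (F i))%E; last first.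
  rewrite -sumEFin; apply: eq_bigr => i _; congr EFin.
  by rewrite cm_diracE /= expr0n addr0 sqrtr_sqr ger0_norm// indicE.
have mU : measurable (\big[setU/set0]_(i < n) F i).
  by apply: bigsetU_measurable => i _; exact: mF.
rewrite big_mkord -(measure_semi_additive _ _ mF tF mU).
apply: le_measure; rewrite ?inE//.
by rewrite -bigcup_mkord; apply: bigcup_sub => i _; exact: FE.
Qed.

End point_mass.

(** * Left translation on a topological group *)

Section translation.
Context (R : realType) (G : topologicalGroupType).
Local Notation M := (measure_algebra R G).

(** The type [borel G] forgets the group structure and the topology of [G]; this
is the multiplication of [G] between the corresponding measurable spaces. *)
Definition ltranslate (x : G) : borel G -> borel G := fun y => (x * (y : G))%g.

Lemma continuous_ltranslate (x : G) : continuous (fun y : G => (x * y)%g).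
Proof.
move=> y; apply: (@continuous_comp _ _ _ (fun y : G => (x, y))
  (fun p : G * G => (p.1 * p.2)%g)); last exact: mulg_continuous.
by apply: cvg_pair; [exact: cvg_cst|exact: cvg_id].
Qed.

Lemma compact_ltranslate (x : G) (K : set G) :
  compact K -> compact (ltranslate x @^-1` K : set G).
Proof.
move=> cK; rewrite (_ : _ @^-1` _ = (fun y : G => x^-1 * y)%g @` K).
  by apply: continuous_compact cK; apply: continuous_subspaceT; exact: continuous_ltranslate.
apply/seteqP; split => [y Ky|_ [y Ky <-]]; last by rewrite /ltranslate /= mulVKg.
by exists (x * y)%g => //; rewrite mulKg.
Qed.

(** The bad [x] are the [k * l^-1] with [k] in [K] and [l] in [L]: they form a
continuous image of [K `*` L], and would otherwise exhaust [G]. *)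
Lemma compact_ltranslate_disjoint (K L : set G) :
  ~ compact [set: G] -> compact K -> compact L ->
  exists x : G, L `&` (ltranslate x @^-1` K) = set0.
Proof.
move=> ncG cK cL; apply: contrapT => noX; apply: ncG.
rewrite (_ : [set: G] = (fun p : G * G => p.1 * p.2^-1)%g @` (K `*` L)).
  apply: continuous_compact (compact_setX cK cL); apply: continuous_subspaceT.
  move=> p; apply: (@continuous_comp _ _ _ (fun p : G * G => (p.1, p.2^-1)%g)
    (fun p : G * G => (p.1 * p.2)%g)); last exact: mulg_continuous.
  apply: cvg_pair; first exact: cvg_fst.
  by apply: continuous_comp; [exact: cvg_snd|exact: invg_continuous].
apply/seteqP; split => // x _; apply: contrapT => nx; apply: noX; exists x.
rewrite -subset0 => y [Ly Ky]; apply: nx; exists (x * y, y)%g; first by split.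
by rewrite /= mulgK.
Qed.

Lemma open_borel (U : set G) : open U -> measurable (U : set (borel G)).
Proof. by move=> oU; exact: sub_sigma_algebra. Qed.

Lemma measurable_ltranslate (x : G) : measurable_fun [set: borel G] (ltranslate x).
Proof.
have := @measurability _ _ (borel G) (borel G) setT (ltranslate x) (@open G) erefl.
apply => _ [U oU <-].
rewrite setTI; apply: open_borel.
by apply: open_comp oU => y _; exact: continuous_ltranslate.
Qed.

Lemma measurable_preimage_ltranslate (x : G) (E : set (borel G)) :
  measurable E -> measurable (ltranslate x @^-1` E).
Proof.
by move=> mE; rewrite -[X in measurable X]setTI; exact: measurable_ltranslate.
Qed.

(** Translation is a homeomorphism, so approximations of the preimage of [E] from
inside and outside translate back to approximations of [E]. *)
Lemma ltranslate_regular (x : G) (mu : M) :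
  regular_measure (cm_pushforward (measurable_ltranslate x) mu).
Proof.
move=> E e mE e0.
have [K [U [cK oU KE EU KUe]]] :=
  ma_regular mu (measurable_preimage_ltranslate x mE) e0.
exists (ltranslate x^-1%g @^-1` K), (ltranslate x^-1%g @^-1` U); split.
- exact: compact_ltranslate.
- by apply: open_comp oU => y _; exact: continuous_ltranslate.
- by move=> y /KE; rewrite /preimage /ltranslate /= mulVKg.
- by move=> y Ey; apply: EU; rewrite /preimage /ltranslate /= mulVKg.
apply: le_lt_trans KUe; apply: le_trans (variation_pushforward_le _ _ _) _.
apply: le_variation => y; rewrite /ltranslate /preimage /= => -[].
by rewrite mulKg.
Qed.

Definition ma_ltranslate (x : G) (mu : M) : M :=
  MeasureAlgebra (ltranslate_regular x mu).

Hypothesis hG : hausdorff_space G.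

Lemma closed_borel (C : set G) : closed C -> measurable (C : set (borel G)).
Proof.
by move=> cC; rewrite -[C]setCK; apply: measurableC; apply: open_borel; exact: closed_openC.
Qed.

Lemma compact_borel (K : set G) : compact K -> measurable (K : set (borel G)).
Proof. by move=> cK; apply: closed_borel; exact: compact_closed. Qed.

(** Points are closed, so the difference between the outer and the inner
approximation can be chosen to miss [x]. *)
Lemma dirac_regular (x : G) : regular_measure (cm_dirac R (x : borel G)).
Proof.
move=> E e mE e0.
have c1 : compact [set x] by exact: compact_set1.
have [Ex|nEx] := pselect (E x).
- exists [set x], setT; split => //; first exact: openT.
    by move=> _ ->.
  rewrite variation_dirac; last first.
    by apply: measurableD; [exact: measurableT|exact: compact_borel].
  by rewrite indicE memNset ?lte_fin// => -[_]; exact.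
- exists set0, (~` [set x]); split => //.
  + exact: compact0.
  + by rewrite openC; exact: compact_closed.
  + by move=> y Ey yx; apply: nEx; rewrite -yx.
  rewrite variation_dirac; last first.
    by rewrite setD0; apply: measurableC; exact: compact_borel.
  by rewrite indicE memNset ?lte_fin// => -[+ _]; exact.
Qed.

Definition ma_dirac (x : G) : M := MeasureAlgebra (dirac_regular x).

Lemma ma_dirac_nonnegative x : nonnegative (ma_dirac x).
Proof. by move=> E mE; rewrite /ma_dirac /= cm_diracE ler0c. Qed.

Lemma ma_dirac_total_variation x : total_variation (ma_dirac x) = 1%E.
Proof. by rewrite /total_variation variation_dirac// indicT. Qed.

(** The inner integral of the convolution, over [t] distributed as [delta_x], of
the indicator of [t * y \in E], is the indicator of [x * y \in E]. *)
Lemma dirac_convolution (x : G) (mu : M) :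
  is_convolution (ma_dirac x) mu (ma_ltranslate x mu).
Proof.
move=> E mE.
rewrite [RHS](_ : _ = cintegral mu (fun y => (\1_(ltranslate x @^-1` E) y)%:C)).
  by rewrite cintegral_indic//; exact: measurable_preimage_ltranslate.
congr cintegral; apply/funext => y; rewrite /ma_dirac /= cm_diracE.
Qed.

End translation.

(** * Indicators as generalised functions *)

Section gl_algebra.
Context {R : realType} {G : topologicalGroupType}.
Local Notation GL := (GL R G).
Implicit Types (f g h p : GL).

Lemma gl_ext f g : (forall mu x, f mu x = g mu x) -> f = g.
Proof.
move=> fg; apply: val_inj; apply/funext => mu; apply/funext => x; exact: fg.
Qed.

Lemma gl_addE f g mu x : (f + g) mu x = f mu x + g mu x.
Proof. by []. Qed.

Lemma gl_mulE f g mu x : (f * g) mu x = f mu x * g mu x.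
Proof. by []. Qed.

Lemma gl_scaleE (s : R[i]) f mu x : (s *: f) mu x = s * f mu x.
Proof. by []. Qed.

Lemma gl_conjE f mu x : gl_conj f mu x = (f mu x)^*.
Proof. by []. Qed.

Lemma gl_indic_subproof (E : set (borel G)) : measurable E ->
  ((fun _ y => (\1_E y)%:C) : family R G) \in @gl_pred R G.
Proof.
move=> mE; apply/asboolP; split.
- move=> mu; split; [exact: measurable_indic|exact: measurable_cst].
- by move=> mu nu _; exact: aeW.
- apply/family_normP; exists 1 => mu; apply: aeW => x.
  by rewrite /= expr0n addr0 sqrtr_sqr ger0_norm// indicE; case: (_ \in _).
Qed.

(** A bounded Borel function gives a generalised function by taking it as every
coordinate. *)
Definition gl_indic (E : set (borel G)) (mE : measurable E) : GL :=
  MkGL (gl_indic_subproof mE).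

Lemma gl_indicE E (mE : measurable E) mu x :
  gl_indic mE mu x = (\1_E x)%:C.
Proof. by []. Qed.

(** The union is a variable [AB] with an equation so that the lemma also applies
to the full space, whose measurability proof is not one about a union. *)
Lemma gl_indicU (A B AB : set (borel G)) (mA : measurable A)
    (mB : measurable B) (mAB : measurable AB) :
  AB = A `|` B -> A `&` B = set0 ->
  gl_indic mAB = gl_indic mA + gl_indic mB.
Proof.
move=> eAB AB0; apply: gl_ext => mu x; rewrite gl_addE !gl_indicE -raddfD/=.
congr (_%:C); rewrite eAB !indicE in_setU.
have [Ax|_] := boolP (x \in A); have [Bx|_] := boolP (x \in B);
  rewrite ?addr0 ?add0r//.
by have : x \in A `&` B; [rewrite in_setI Ax Bx|rewrite AB0 in_set0].
Qed.

Lemma gl_indicC (A : set (borel G)) (mA : measurable A)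
    (mCA : measurable (~` A)) : gl_indic mA + gl_indic mCA = 1.
Proof.
rewrite -(@gl_indicU _ _ _ mA mCA measurableT) ?setUv ?setICr//.
by apply: gl_ext => mu x; rewrite gl_indicE indicT.
Qed.

Lemma gl_indic_conj E (mE : measurable E) : gl_conj (gl_indic mE) = gl_indic mE.
Proof. by apply: gl_ext => mu x /=; rewrite oppr0. Qed.

Lemma gl_indic_idem E (mE : measurable E) :
  gl_indic mE * gl_indic mE = gl_indic mE.
Proof.
apply: gl_ext => mu x; rewrite gl_mulE !gl_indicE indicE.
by case: (_ \in _); rewrite ?mulr1 ?mulr0.
Qed.

(** Both sides evaluate on [mu] to the measure [mu] gives to [x^-1 E]: directly
for the translated indicator, and through the image of [mu] for [\1_E]. *)
Lemma is_circ_dirac_indic (hG : hausdorff_space G) (x : G) (E : set (borel G))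
    (mE : measurable E) (mxE : measurable (ltranslate x @^-1` E)) :
  is_circ (ma_dirac R hG x) (gl_indic mE) (gl_indic mxE).
Proof.
move=> mu; exists (ma_ltranslate x mu); first exact: dirac_convolution.
by rewrite /pairing /= !cintegral_indic.
Qed.

Lemma gl_conj_mul_ge0 g : gl_ge0 (gl_conj g * g).
Proof. by exists g => mu; exact: aeW. Qed.

Lemma gl_conj_mul_expand (s : R[i]) p h :
  gl_conj (s *: p + h) * (s *: p + h) =
  (s^* * s) *: (gl_conj p * p) + s^* *: (gl_conj p * h)
  + s *: (gl_conj h * p) + gl_conj h * h.
Proof.
apply: gl_ext => mu x; rewrite !(gl_mulE, gl_conjE, gl_addE, gl_scaleE).
rewrite rmorphD rmorphM /=; ring.
Qed.

End gl_algebra.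

(** * Invariant means on a non-compact group *)

Lemma affine_ge0_slope_eq0 (R : realFieldType) (t c : R) :
  (forall k, 0 <= k * t + c) -> t = 0.
Proof.
move=> h; apply: contrapT => /eqP t0; have := h (- (c + 1) / t).
by rewrite divfK// opprD addrAC addNr add0r oppr_ge0 ler10.
Qed.

Section mean.
Context (R : realType) (G : topologicalGroupType).
Local Notation GL := (GL R G).
Implicit Types (f h p : GL).
Variable m : GL_dual R G.
Hypothesis m_ge0 : forall f, gl_ge0 f -> 0 <= m f.

(** Positivity of [m] at [(s p + h)^* (s p + h)] has no quadratic term in [s]
when [m (p^* p) = 0]; what remains is affine over the reals in [s], bounded
below, and hence constant.  Real and imaginary [s] together isolate
[m (p^* h)]. *)
Lemma mean_cauchy_schwarz0 p h :
  m (gl_conj p * p) = 0 -> m (gl_conj p * h) = 0.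
Proof.
move=> mp0.
set a := m (gl_conj p * h); set b := m (gl_conj h * p).
set c := m (gl_conj h * h).
have q_ge0 (s : R[i]) : 0 <= s^* * a + s * b + c.
  have := m_ge0 (gl_conj_mul_ge0 (s *: p + h)).
  by rewrite gl_conj_mul_expand !linearD !linearZ /= mp0 mulr0 add0r.
case: a b c q_ge0 => ar ai [br bi] [cr ci] q_ge0.
(* The scalar [s] is taken real, then purely imaginary. *)
have re (k : R) : 0 <= k * (ar + br) + cr /\ k * (ai + bi) + ci = 0.
  have := q_ge0 (k +i* 0); simpc => /andP[/eqP h1 h2].
  by split; [move: h2|move: h1]; lra.
have im (k : R) : 0 <= k * (ai - bi) + cr /\ k * (br - ar) + ci = 0.
  have := q_ge0 (0 +i* k); simpc => /andP[/eqP h1 h2].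
  by split; [move: h2|move: h1]; lra.
have r1 := affine_ge0_slope_eq0 (fun k => (re k).1).
have r2 := affine_ge0_slope_eq0 (fun k => (im k).1).
have [[_ r3] [_ r4]] := (re 0, re 1).
have [_ r5] := im 1.
by congr (_ +i* _); lra.
Qed.

Lemma mean_indic_ge0 E (mE : measurable E) : 0 <= m (gl_indic mE).
Proof.
by rewrite -(gl_indic_idem mE) -{1}(gl_indic_conj mE); exact/m_ge0/gl_conj_mul_ge0.
Qed.

Hypotheses (m1 : m 1 = 1) (m_inv : topological_left_invariant m).
Hypotheses (hG : hausdorff_space G) (ncG : ~ compact [set: G]).

(** The compact set is a disjoint union of [n] translates of [K]; keeping only
the union makes the induction need no list of translating points. *)
Lemma mean_indic_multiples (K : set G) (cK : compact K) (n : nat) :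
  exists (L : set G) (cL : compact L),
    m (gl_indic (compact_borel hG cL)) = m (gl_indic (compact_borel hG cK)) *+ n.
Proof.
elim: n => [|n [L [cL mL]]].
  exists set0, (@compact0 G).
  rewrite (_ : gl_indic _ = 0) ?linear0//.
  by apply: gl_ext => mu x; rewrite gl_indicE indic0.
have [x disj] := compact_ltranslate_disjoint ncG cK cL.
have cxK : compact (ltranslate x @^-1` K : set G) by exact: compact_ltranslate.
have cLxK : compact (L `|` ltranslate x @^-1` K : set G) by exact: compactU.
exists (L `|` ltranslate x @^-1` K), cLxK.
rewrite (gl_indicU (compact_borel hG cL) (compact_borel hG cxK) _ erefl disj).
rewrite linearD mL mulrSr; congr (_ + _).
apply: (m_inv (zeta := ma_dirac R hG x)).
- exact: ma_dirac_nonnegative.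
- exact: ma_dirac_total_variation.
- exact: is_circ_dirac_indic.
Qed.

(** The complement of a disjoint union of [n] translates has nonnegative mean
[1 - n * m \1_K]; the archimedean property concludes. *)
Lemma mean_indic_compact (K : set G) (cK : compact K) :
  m (gl_indic (compact_borel hG cK)) = 0.
Proof.
have := mean_indic_ge0 (compact_borel hG cK).
have := mean_indic_multiples cK.
case: (m _) => a b mult; rewrite lecE /= => /andP[/eqP-> a0].
congr (_ +i* _); apply/eqP; rewrite eq_le a0 andbT leNgt; apply/negP => {}a0.
pose n := (Num.truncn a^-1).+1.
have [L [cL mL]] := mult n.
have mCL := measurableC (compact_borel hG cL).
have := mean_indic_ge0 mCL.
have := congr1 m (gl_indicC (compact_borel hG cL) mCL).
rewrite linearD m1 mL => /(canRL (addKr _)) ->.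
rewrite lecE => /andP[_]; rewrite raddfD raddfN raddfMn /= addrC subr_ge0.
apply/negP; rewrite -ltNge -mulr_natr -ltr_pdivrMl// mulr1.
exact: truncnS_gt.
Qed.

(** Up to a set of mean zero, [f] is its restriction to the complement of a large
compact set, where it is small. *)
Lemma mean_vanishing_eq0 f : vanishes_at_infinity f -> m f = 0.
Proof.
move=> f0; have [C mC] := gl_functional_bounded m.
apply: eq0_normc; apply/eqP; rewrite eq_le normc_ge0 andbT.
apply/ler_addgt0Pl => e e0; rewrite addr0.
(* A bound of [m] need not be positive; [Num.max C 1] is a positive one. *)
have D0 : 0 < Num.max C 1 by rewrite lt_max ltr01 orbT.
have [K cK fK] := f0 (e / Num.max C 1) (divr_gt0 e0 D0).
pose mK := compact_borel hG cK; have mCK := measurableC mK.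
have mK0 : m (gl_indic mK) = 0 := mean_indic_compact cK.
have -> : m f = m (f * gl_indic mCK).
  rewrite -[in LHS](mulr1 f) -(gl_indicC mK mCK) mulrDr linearD.
  rewrite [f * gl_indic mK]mulrC -(gl_indic_conj mK) mean_cauchy_schwarz0 ?add0r//.
  by rewrite gl_indic_conj gl_indic_idem.
rewrite -lee_fin; apply: (le_trans (mC _)).
have N0 : (0 <= gl_norm (f * gl_indic mCK)%R)%E.
  apply: le_trans (ereal_sup_ubound _); last first.
    by exists (ma_dirac R hG 1%g).
  exact: Lnorm_ge0.
apply: (@le_trans _ _ ((Num.max C 1)%:E * gl_norm (f * gl_indic mCK)%R)%E).
  by rewrite lee_wpmul2r// lee_fin le_max lexx.
have -> : e%:E = ((Num.max C 1)%:E * (e / Num.max C 1)%:E)%E.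
  by rewrite -EFinM mulrCA divff ?mulr1// lt0r_neq0.
apply: lee_wpmul2l; first by rewrite lee_fin ltW.
by apply: ge_ereal_sup => _ [mu _ <-]; exact/ltW/fK.
Qed.

End mean.

Theorem proposition3p6 (R : realType) (G : topologicalGroupType)
    (G_hausdorff : hausdorff_space G)
    (G_locally_compact : locally_compact [set: G])
    (G_noncompact : ~ compact [set: G])
    (m : GL_dual R G)
    (m_mean : is_mean m)
    (m_invariant : topological_left_invariant m) :
  annihilator (@GL0 R G) m.
Proof.
by move=> f f0; case: m_mean => m1 m_ge0; exact: mean_vanishing_eq0 f0.
Qed.
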